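(* Consider the participation constraints $$\frac{(\rho-\beta_i)^2}{(\Gamma+\tau)\rho^2}-\frac{\beta_i}{\rho^2}-\frac{\lambda_i}{\gamma_i+\rho+\tau}\ \ge\ \frac1\tau-\frac{\lambda_i}{\rho+\tau}\qquad\text{for all } i\in\{1,\dots,N\},$$ where $\beta_k\in[0,\rho]$, $\Gamma=\sum_{k=1}^N\beta_k$ and $\gamma_i=\sum_{k\ne i}\beta_k$, in the limit $\beta_k\to0$ for all $k$ (small perturbations of non-collaboration). A small beneficial deviation for everyone exists if and only if $$\xi_i\ge0\ \text{ for all } i\qquad\text{and}\qquad\sum_{i=1}^N\xi_i>1,$$ where $$\xi_i=\left(1+\frac{(\rho+\tau)^2}{\tau^2\rho^2\left(\frac{\lambda_i}{(\rho+\tau)^2}-\frac1{\tau^2}\right)}\right)^{-1}.$$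
   Context: Setting (Bayesian mean estimation with $N$ clients). A parameter $\mu\sim N(0,1/\tau)$ is drawn. Client $i$ holds $n$ observations $x_i^1,\dots,x_i^n$ sampled from $N(\mu,\sigma^2)$ and reveals to the others the message $m_i=\bar x_i+\epsilon_i$, where $\bar x_i$ is its sample mean and $\epsilon_i\sim N(0,\alpha_i^2)$. Put $\rho=n/\sigma^2$ and $\beta_i=1/(1/\rho+\alpha_i^2)\in[0,\rho]$; $\beta_i\to0$ corresponds to $\alpha_i\to\infty$. The squared accuracy loss $\mathrm{Err}_i^2$ of client $i$ is the mean squared error of the best predictor of $\mu$ from its own data and all messages. Its squared privacy loss is $\mathrm{Leak}_i^2=\sigma^2+\frac1\tau-E\left(\frac1n\sum_{j=1}^n(\hat x_i^j-x_i^j)^2\right)$, where $\hat x_i^j$ is the best predictor of $x_i^j$ from the messages $m_1,\dots,m_N$. The parameter $\lambda_i$ measures the importance of accuracy for client $i$, whose utility is $$u_i=-\mathrm{Leak}_i^2-\lambda_i\mathrm{Err}_i^2=\left(\frac1{\alpha_i^2}+\frac{\rho(\gamma_i+\tau)}{\gamma_i+\rho+\tau}\right)^{-1}-\frac1\rho-\frac1\tau-\frac{\lambda_i}{\gamma_i+\rho+\tau}.$$ The utility of training alone is the limit as all $\beta_k\to0$, namely $u_i^0=-\frac{\lambda_i}{\rho+\tau}$. A protocol is mutually beneficial (beneficial for everyone) if $u_i\ge u_i^0$ for all $i$, which is the displayed system of participation constraints. The limit in which all $\beta_k\to0$ corresponds to a small perturbation of the status quo of non-collaboration or, alternatively, to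 the situation where participants have a minimal privacy loss; a deviation means a move from this status quo to a choice of $\beta_1,\dots,\beta_N$ near it, and the constraints are analysed through their first-order approximation there.
   Formalization: A small beneficial deviation also requires that some client gain to first order (at least a fixed multiple of Γ), since with non-strict constraints alone the claim can fail when the ξ_i sum to 1; λ_i ≥ 0 is assumed, and ξ_i is read as 0 where its inner denominator vanishes. *)

(* Defs.v *)
From mathcomp Require Import all_boot all_order all_algebra.
From mathcomp Require Import reals.
Set Implicit Arguments.
Unset Strict Implicit.
Unset Printing Implicit Defensive.
Import Order.TTheory GRing.Theory Num.Theory.
Local Open Scope ring_scope.

(* The family beta : 'I_N -> R is the vector (beta_1, ..., beta_N) with        *)
(* beta_i = 1 / (1 / rho + alpha_i ^+ 2), and lambda : 'I_N -> R collects the  *)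
(* weights lambda_i of accuracy.                                              *)

Definition Gamma (R : realType) (N : nat) (beta : 'I_N -> R) : R :=
  \sum_(k < N) beta k.

Definition gamma (R : realType) (N : nat) (beta : 'I_N -> R) (i : 'I_N) : R :=
  \sum_(k < N | k != i) beta k.

(* Utility u_i rewritten in terms of beta, up to the constant: it equals      *)
(* u_i + 1 / tau.                                                             *)
Definition utility (R : realType) (N : nat) (rho tau : R)
    (lambda beta : 'I_N -> R) (i : 'I_N) : R :=
  (rho - beta i) ^+ 2 / ((Gamma beta + tau) * rho ^+ 2)
  - beta i / rho ^+ 2 - lambda i / (gamma beta i + rho + tau).

(* Utility of training alone, shifted by the same constant: u_i^0 + 1 / tau.  *)
Definition utility0 (R : realType) (N : nat) (rho tau : R)
    (lambda : 'I_N -> R) (i : 'I_N) : R :=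
  1 / tau - lambda i / (rho + tau).

Definition participation (R : realType) (N : nat) (rho tau : R)
    (lambda beta : 'I_N -> R) : Prop :=
  forall i : 'I_N,
    utility0 rho tau lambda i <= utility rho tau lambda beta i.

(* Arbitrarily close to the status quo beta = 0 there is a deviation          *)
(* satisfying all the participation constraints for which the benefit is      *)
(* visible in the first-order approximation: some client gains at least a     *)
(* fixed multiple delta of the size Gamma beta of the deviation (the l1 norm, *)
(* as beta >= 0). A gain of higher order only is not counted: when    *)
(* \sum_i xi_i = 1, no deviation is harmless to everyone and profitable to    *)
(* someone at first order, and second-order terms decide.                     *)
Definition small_beneficial_deviation (R : realType) (N : nat) (rho tau : R)
    (lambda : 'I_N -> R) : Prop :=
  exists2 delta : R, 0 < delta &
  forall eps : R, 0 < eps ->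
  exists beta : 'I_N -> R,
    [/\ forall k, 0 <= beta k <= rho,
        forall k, beta k < eps,
        0 < Gamma beta,
        participation rho tau lambda beta &
        exists i : 'I_N,
          delta * Gamma beta
            <= utility rho tau lambda beta i - utility0 rho tau lambda i].

(* When the inner denominator vanishes, the formula is read as                *)
(* (1 + oo)^-1 = 0, its continuous extension; with the convention x / 0 = 0   *)
(* it would evaluate to 1.                                                    *)
Definition xi (R : realType) (N : nat) (rho tau : R)
    (lambda : 'I_N -> R) (i : 'I_N) : R :=
  let a := lambda i / (rho + tau) ^+ 2 - 1 / tau ^+ 2 in
  if a == 0 then 0
  else (1 + (rho + tau) ^+ 2 / (tau ^+ 2 * rho ^+ 2 * a))^-1.

(* Main.v *)
Require Import Defs.
From mathcomp Require Import all_boot all_order all_algebra.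
From mathcomp Require Import reals.
From mathcomp Require Import ring lra.
Set Implicit Arguments.
Unset Strict Implicit.
Unset Printing Implicit Defensive.
Import Order.TTheory GRing.Theory Num.Theory.
Local Open Scope ring_scope.

                                                          
                                                                            
                                                 
                                                                           
                                                                          
                                                                             
                                                                              
                                                                              
                                                                           
                                                                            

(** Near [beta = 0] the gain of client i over training alone is, at first order, A_i gamma_i - B
    beta_i, where A_i = [benefit_slope i] prices what the others disclose and B = [cost_slope] what
    i discloses. Since Gamma = beta_i + gamma_i, this equals A_i Gamma - (A_i + B) beta_i. As A_i +
    B > 0 and xi_i = A_i / (A_i + B), participation at first order reads beta_i <= xi_i Gamma.

    Necessity: [beta_i >= 0] forces xi_i >= 0, and summing over i gives 1 <= sum xi_i; the client
    gaining at rate delta makes this strict. Sufficiency: beta proportional to xi leaves each client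
    the linear gain A_i (1 - 1/S) Gamma, with S = sum xi_i > 1.

    The passage between linear and true gain rests on the O(Gamma^2) bounds [gain_le] and [gain_ge].
    A client with A_i = 0 has no linear gain to absorb an error, and is settled by the exact
    computation [gain_indifferent_ge0]. *)

(** Passage to the limit: [x] will be the error, a constant times Gamma, left after dividing by
    Gamma. *)
Lemma ger0_of_small_bound (R : realFieldType) (a c : R) :
  (forall e, 0 < e -> exists2 x, x < e & a <= c + x) -> a <= c.
Proof.
move=> h; apply/ler_addgt0Pr => e /h[x xe] ax.
by apply: le_trans ax _; rewrite lerD2l ltW.
Qed.

Lemma inv_add_ge_tangent (R : realFieldType) (x a : R) :
  0 < a -> 0 <= x -> a^-1 - x / a ^+ 2 <= (x + a)^-1.
Proof.
move=> a0 x0; rewrite -subr_ge0.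
have xa0 : 0 < x + a by lra.
have -> : (x + a)^-1 - (a^-1 - x / a ^+ 2) = x ^+ 2 / (a ^+ 2 * (x + a)).
  by field; rewrite !gt_eqF.
by rewrite divr_ge0 ?sqr_ge0// mulr_ge0 ?sqr_ge0// ltW.
Qed.

Lemma inv_add_le_quadratic (R : realFieldType) (x a : R) :
  0 < a -> 0 <= x -> (x + a)^-1 <= a^-1 - x / a ^+ 2 + x ^+ 2 / a ^+ 3.
Proof.
move=> a0 x0; rewrite -subr_ge0.
have xa0 : 0 < x + a by lra.
have -> : a^-1 - x / a ^+ 2 + x ^+ 2 / a ^+ 3 - (x + a)^-1 =
    x ^+ 3 / (a ^+ 3 * (x + a)).
  by field; rewrite !gt_eqF.
by rewrite divr_ge0 ?exprn_ge0// mulr_ge0 ?exprn_ge0// ltW.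
Qed.

Lemma exists_pos_lower_bound (R : realFieldType) (I : finType) (P : pred I)
    (c : I -> R) (u : R) :
  0 < u -> (forall i, P i -> 0 < c i) ->
  exists t, [/\ 0 < t, t <= u & forall i, P i -> t <= c i].
Proof.
move=> u0 c0; exists (\big[Num.min/u]_(i | P i) c i); split.
- by elim/big_ind: _ => // x y x0 y0; rewrite lt_min x0.
- exact: bigmin_le_id.
- by move=> i Pi; exact: bigmin_le_cond.
Qed.

(** * First-order expansion of the gain, and its quadratic error *)

Section Gain.
Variables (R : realType) (N : nat) (rho tau : R) (lambda : 'I_N -> R).
Hypotheses (rho_gt0 : 0 < rho) (tau_gt0 : 0 < tau).
Hypothesis lambda_ge0 : forall i, 0 <= lambda i.

Definition benefit_slope (i : 'I_N) : R :=
  lambda i / (rho + tau) ^+ 2 - 1 / tau ^+ 2.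

Definition cost_slope : R := (rho + tau) ^+ 2 / (tau ^+ 2 * rho ^+ 2).

Definition linear_gain (beta : 'I_N -> R) (i : 'I_N) : R :=
  benefit_slope i * Gamma beta - (benefit_slope i + cost_slope) * beta i.

Definition gain (beta : 'I_N -> R) (i : 'I_N) : R :=
  utility rho tau lambda beta i - utility0 rho tau lambda i.

(** Coefficient of the upper error term. It is free of lambda because the accuracy term is concave
    in gamma_i and so lies below its tangent. *)
Definition gain_curvature : R :=
  1 / tau ^+ 3 + 2 / (rho * tau ^+ 2) + 1 / (rho ^+ 2 * tau).

Let rhotau_gt0 : 0 < rho + tau. Proof. exact: addr_gt0. Qed.

Lemma cost_slope_gt0 : 0 < cost_slope.
Proof. by rewrite divr_gt0 ?mulr_gt0 ?exprn_gt0. Qed.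

Lemma gain_curvature_gt0 : 0 < gain_curvature.
Proof. by rewrite !addr_gt0// divr_gt0// ?mulr_gt0 ?exprn_gt0. Qed.

(** The term -1/tau^2, which can make the benefit slope negative, cancels against the 1/tau^2 in the
    expanded cost slope. *)
Lemma benefit_cost_slope_gt0 i : 0 < benefit_slope i + cost_slope.
Proof.
have -> : benefit_slope i + cost_slope =
    lambda i / (rho + tau) ^+ 2 + (2 / (rho * tau) + 1 / rho ^+ 2).
  by rewrite /benefit_slope /cost_slope; field; rewrite !gt_eqF.
rewrite ltr_wpDl ?divr_ge0 ?exprn_ge0 ?(ltW rhotau_gt0)//.
by rewrite addr_gt0// divr_gt0 ?mulr_gt0 ?exprn_gt0.
Qed.

(** This quotient also covers the degenerate case of [xi], so no case distinction is needed
    afterwards. *)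
Lemma xiE i :
  xi rho tau lambda i = benefit_slope i / (benefit_slope i + cost_slope).
Proof.
rewrite /xi -/(benefit_slope i).
have [->|A0] := eqVneq (benefit_slope i) 0; first by rewrite mul0r.
have AB := lt0r_neq0 (benefit_cost_slope_gt0 i).
rewrite -[RHS]invf_div; congr (_^-1).
rewrite /cost_slope; field.
by rewrite A0 !gt_eqF.
Qed.

Lemma xi_ge0 i : (0 <= xi rho tau lambda i) = (0 <= benefit_slope i).
Proof. by rewrite xiE pmulr_lge0// invr_gt0 benefit_cost_slope_gt0. Qed.

Lemma mulr_xi i :
  (benefit_slope i + cost_slope) * xi rho tau lambda i = benefit_slope i.
Proof. by rewrite xiE mulrC divfK// gt_eqF ?benefit_cost_slope_gt0. Qed.

Lemma Gamma_gamma (beta : 'I_N -> R) i : Gamma beta = beta i + gamma beta i.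
Proof. by rewrite /Gamma (bigD1 i). Qed.

Section NonnegDeviation.
Variable beta : 'I_N -> R.
Hypothesis beta_ge0 : forall k, 0 <= beta k.

Lemma gamma_ge0 i : 0 <= gamma beta i.
Proof. exact: sumr_ge0. Qed.

Lemma beta_le_Gamma i : beta i <= Gamma beta.
Proof. by rewrite (Gamma_gamma _ i) lerDl gamma_ge0. Qed.

Lemma Gamma_ge0 : 0 <= Gamma beta.
Proof. exact: sumr_ge0. Qed.

                                                                        
                                            
(** Each inverse is isolated, so that the tangent and quadratic bounds can be substituted term by
    term. *)
Lemma gainE i : gain beta i =
  (1 - 2 * (beta i / rho) + (beta i / rho) ^+ 2) * (Gamma beta + tau)^-1
  - beta i / rho ^+ 2 - tau^-1
  + lambda i * ((rho + tau)^-1 - (gamma beta i + (rho + tau))^-1).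
Proof.
have G0 : 0 < Gamma beta + tau by rewrite ltr_wpDl// Gamma_ge0.
have g0 : 0 < gamma beta i + (rho + tau) by rewrite ltr_wpDl// gamma_ge0.
rewrite /gain /utility /utility0 -addrA.
by field; rewrite ?gt_eqF// -addrA.
Qed.

Lemma linear_gainE i : linear_gain beta i =
  lambda i * (gamma beta i / (rho + tau) ^+ 2) - Gamma beta / tau ^+ 2
  - 2 * (beta i / rho) / tau - beta i / rho ^+ 2.
Proof.
have -> : gamma beta i = Gamma beta - beta i.
  by rewrite (Gamma_gamma _ i) addrC addKr.
rewrite /linear_gain /benefit_slope /cost_slope.
by field; rewrite !gt_eqF.
Qed.

Lemma gain_le i :
  gain beta i <= linear_gain beta i + gain_curvature * Gamma beta ^+ 2.
Proof.
rewrite gainE linear_gainE.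
have G0 := Gamma_ge0; have g0 := gamma_ge0 i; have bG := beta_le_Gamma i.
have b0 := beta_ge0 i.
have H1 := inv_add_le_quadratic tau_gt0 G0.
have H2 := inv_add_ge_tangent tau_gt0 G0.
have H3 := inv_add_ge_tangent rhotau_gt0 g0.
have H4 : (Gamma beta + tau)^-1 <= tau^-1.
  by rewrite lef_pV2 ?posrE ?lerDr// ltr_wpDl.
have b0' : 0 <= beta i / rho by rewrite divr_ge0// ltW.
have bG' : beta i / rho <= Gamma beta / rho.
  by rewrite ler_pM2r ?invr_gt0.
have K2 := ler_wpM2l b0' H2.
have K3 := ler_wpM2l (lambda_ge0 i) H3.
have K4 := ler_wpM2l (sqr_ge0 (beta i / rho)) H4.
have K5 : (beta i / rho) ^+ 2 / tau <= (Gamma beta / rho) ^+ 2 / tau.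
  by rewrite ler_pM2r ?invr_gt0// ler_sqr// nnegrE (le_trans b0').
have K6 : beta i / rho * (Gamma beta / tau ^+ 2)
    <= Gamma beta / rho * (Gamma beta / tau ^+ 2).
  by rewrite ler_wpM2r// divr_ge0// exprn_ge0// ltW.
have -> : gain_curvature * Gamma beta ^+ 2 = Gamma beta ^+ 2 / tau ^+ 3
    + 2 * (Gamma beta / rho * (Gamma beta / tau ^+ 2))
    + (Gamma beta / rho) ^+ 2 / tau.
  by rewrite /gain_curvature; field; rewrite !gt_eqF.
lra.
Qed.

(** Only the accuracy term costs a quadratic error here: the privacy terms are bounded below by
    tangents, and the square of beta_i / rho is dropped as nonnegative. *)
Lemma gain_ge i :
  linear_gain beta i - lambda i / (rho + tau) ^+ 3 * Gamma beta ^+ 2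
  <= gain beta i.
Proof.
rewrite gainE linear_gainE.
have G0 := Gamma_ge0; have g0 := gamma_ge0 i; have b0 := beta_ge0 i.
have H1 := inv_add_ge_tangent tau_gt0 G0.
have H2 : (Gamma beta + tau)^-1 <= tau^-1.
  by rewrite lef_pV2 ?posrE ?lerDr// ltr_wpDl.
have H3 := inv_add_le_quadratic rhotau_gt0 g0.
have b0' : 0 <= beta i / rho by rewrite divr_ge0// ltW.
have K2 := ler_wpM2l b0' H2.
have K3 := ler_wpM2l (lambda_ge0 i) H3.
have K4 : 0 <= (beta i / rho) ^+ 2 * (Gamma beta + tau)^-1.
  by rewrite mulr_ge0 ?sqr_ge0// invr_ge0 addr_ge0// ltW.
have K5 : lambda i / (rho + tau) ^+ 3 * gamma beta i ^+ 2
    <= lambda i / (rho + tau) ^+ 3 * Gamma beta ^+ 2.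
  rewrite ler_wpM2l ?divr_ge0 ?exprn_ge0 ?(ltW rhotau_gt0)//.
  by rewrite ler_sqr ?nnegrE// (Gamma_gamma _ i) lerDr.
have K6 : lambda i * (gamma beta i ^+ 2 / (rho + tau) ^+ 3)
    = lambda i / (rho + tau) ^+ 3 * gamma beta i ^+ 2 by rewrite mulrA mulrAC.
lra.
Qed.

(** The linear gain vanishes here, so [gain_ge] gives only a nonpositive lower bound. Substituting
    the value of lambda_i forced by the zero slope shows that the exact gain is a nonnegative
    second-order quantity. *)
Lemma gain_indifferent_ge0 i :
  benefit_slope i = 0 -> beta i = 0 -> 0 <= gain beta i.
Proof.
move=> A0 bi0; rewrite gainE.
have -> : gamma beta i = Gamma beta by rewrite (Gamma_gamma _ i) bi0 add0r.
have -> : lambda i = (rho + tau) ^+ 2 / tau ^+ 2.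
  move/eqP: A0; rewrite subr_eq0 => /eqP A0.
  by rewrite -[LHS](divfK (lt0r_neq0 (exprn_gt0 2 rhotau_gt0))) A0 mul1r mulrC.
have G0 := Gamma_ge0.
have Gt0 : 0 < Gamma beta + tau by rewrite ltr_wpDl.
have Grt0 : 0 < Gamma beta + (rho + tau) by rewrite ltr_wpDl.
rewrite bi0; set x := (X in 0 <= X).
have -> : x = rho * Gamma beta ^+ 2 /
    (tau ^+ 2 * ((Gamma beta + tau) * (Gamma beta + (rho + tau)))).
  rewrite /x; field.
  by rewrite !gt_eqF.
by rewrite divr_ge0 ?mulr_ge0 ?sqr_ge0 // ltW.
Qed.

End NonnegDeviation.

(** * Necessity of the conditions on xi *)

Lemma small_deviations :
  small_beneficial_deviation rho tau lambda ->
  exists2 delta, 0 < delta & forall e, 0 < e -> exists beta : 'I_N -> R,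
    [/\ forall k, 0 <= beta k, 0 < Gamma beta, Gamma beta < e,
        forall i, 0 <= gain beta i &
        exists i, delta * Gamma beta <= gain beta i].
Proof.
move=> [delta delta0 h]; exists delta => // e e0.
(* Dividing by N + 1 rather than N keeps the total strictly below e and allows N = 0. *)
have [beta [b_rho b_e G0 part ex]] := h (e / N.+1%:R) (divr_gt0 e0 (ltr0Sn _ _)).
exists beta; split => //.
- by move=> k; case/andP: (b_rho k).
- apply: (@le_lt_trans _ _ (\sum_(k < N) e / N.+1%:R)).
    by apply: ler_sum => k _; exact: ltW.
  rewrite sumr_const card_ord -[ltLHS]mulr_natr mulrAC ltr_pdivrMr ?ltr0Sn//.
  by rewrite ltr_pM2l// ltr_nat.
- by move=> i; rewrite subr_ge0; exact: part.
Qed.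

(** Dropping the nonpositive own-disclosure term leaves 0 <= A_i Gamma + C Gamma^2, with C =
    [gain_curvature]; divide by Gamma and let it tend to 0. *)
Lemma benefit_slope_ge0_of_deviation i :
  small_beneficial_deviation rho tau lambda -> 0 <= benefit_slope i.
Proof.
case/small_deviations => delta _ h; apply: ger0_of_small_bound => e e0.
have C0 := gain_curvature_gt0.
have [beta [b0 G0 Ge part _]] := h (e / gain_curvature) (divr_gt0 e0 C0).
exists (gain_curvature * Gamma beta); first by rewrite mulrC -ltr_pdivlMr.
rewrite -(pmulr_lge0 _ G0).
have := le_trans (part i) (gain_le b0 i).
rewrite /linear_gain.
have := mulr_ge0 (ltW (benefit_cost_slope_gt0 i)) (b0 i).
lra.
Qed.

Lemma sum_xi_gt1_of_deviation :
  small_beneficial_deviation rho tau lambda ->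
  1 < \sum_(i < N) xi rho tau lambda i.
Proof.
move=> dev; have A0 i := benefit_slope_ge0_of_deviation i dev.
have B0 := cost_slope_gt0; have C0 := gain_curvature_gt0.
case/small_deviations: dev => delta delta0 h.
(* The gaining client may change with the deviation, so A_j + B is bounded by a [D] independent of
   j. *)
set D := \sum_i benefit_slope i + cost_slope.
have D0 : 0 < D by rewrite ltr_wpDl// sumr_ge0.
set K := N%:R * (gain_curvature / cost_slope).
have K0 : 0 <= K by rewrite mulr_ge0// divr_ge0 ?ltW.
suff : 1 + delta / D <= \sum_(i < N) xi rho tau lambda i.
  by apply: lt_le_trans; rewrite ltrDl divr_gt0.
apply: ger0_of_small_bound => e e0.
have [|beta [b0 G0 Ge part [j gj]]] := h (e / (K + 1)).
  by rewrite divr_gt0// ltr_wpDl.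
exists (K * Gamma beta).
  have : Gamma beta * (K + 1) < e by rewrite -ltr_pdivlMr// ltr_wpDl.
  lra.
rewrite -(ler_pM2r G0).
(* This is [gain_le] divided by A_i + B, with 1 / (A_i + B) <= 1 / B in the error term. In the sum
   over i, the beta_i add up to Gamma. *)
have bound i : beta i + gain beta i / (benefit_slope i + cost_slope) <=
    xi rho tau lambda i * Gamma beta
    + gain_curvature / cost_slope * Gamma beta ^+ 2.
  have AB0 := benefit_cost_slope_gt0 i.
  have := gain_le b0 i; rewrite /linear_gain -{1}mulr_xi => gi.
  have {}gi : beta i + gain beta i / (benefit_slope i + cost_slope) <=
      xi rho tau lambda i * Gamma beta
      + gain_curvature * Gamma beta ^+ 2 / (benefit_slope i + cost_slope).
    have mulKf x : (benefit_slope i + cost_slope)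
        * (x / (benefit_slope i + cost_slope)) = x.
      by rewrite mulrC divfK ?gt_eqF.
    rewrite -(ler_pM2l AB0) 2!(mulrDr (benefit_slope i + cost_slope)) !mulKf.
    lra.
  apply: le_trans gi _; rewrite lerD2l mulrAC ler_wpM2r ?sqr_ge0//.
  by rewrite ler_wpM2l ?(ltW C0)// lef_pV2 ?posrE// lerDr.
have := ler_sum (index_enum 'I_N) (P := xpredT) (fun i _ => bound i).
rewrite !big_split /= -/(Gamma beta) -mulr_suml sumr_const card_ord => total.
have gain_j : delta / D * Gamma beta <=
    \sum_i gain beta i / (benefit_slope i + cost_slope).
  rewrite (bigD1 j)//=.
  apply: ler_wpDr.
    by apply: sumr_ge0 => i _; rewrite divr_ge0// ltW// benefit_cost_slope_gt0.
  rewrite mulrAC ler_pM//.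
  - by rewrite mulr_ge0 ?ltW.
  - by rewrite invr_ge0 ltW.
  - rewrite lef_pV2 ?posrE ?benefit_cost_slope_gt0// lerD2r.
    by rewrite (bigD1 j)//= lerDl sumr_ge0.
rewrite -[_ *+ N]mulr_natl in total.
rewrite /K; lra.
Qed.

(** * Sufficiency of the conditions on xi *)

Lemma deviation_of_sum_xi_gt1 :
  (forall i, 0 <= xi rho tau lambda i) ->
  1 < \sum_(i < N) xi rho tau lambda i ->
  small_beneficial_deviation rho tau lambda.
Proof.
move=> xi0; set S := \sum_i _ => S1.
have S0 : 0 < S by lra.
have A0 i : 0 <= benefit_slope i by rewrite -xi_ge0.
have [j Aj] : exists j, 0 < benefit_slope j.
  apply/existsP; apply: contraLR S1; rewrite negb_exists => /forallP Ale.
  rewrite -leNgt /S big1 ?ler01// => i _.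
  have /eqP Ai0 : benefit_slope i == 0 by rewrite eq_le A0 andbT leNgt Ale.
  by rewrite xiE Ai0 mul0r.
pose c := 1 - S^-1; have c0 : 0 < c by rewrite subr_gt0 invf_lt1.
pose q i := lambda i / (rho + tau) ^+ 3.
have q0 i : 0 <= q i by rewrite divr_ge0// exprn_ge0// ltW.
(* Half of the linear rate A_j c of client j; the other half pays for the quadratic error. *)
exists (benefit_slope j * c / 2); first by rewrite divr_gt0// mulr_gt0.
move=> eps eps0.
have u0 : 0 < Num.min rho (eps / 2) by rewrite lt_min rho_gt0 divr_gt0.
(* For t below this threshold, q_i t^2 is at most half of the linear gain A_i c t; the + 1 keeps the
   denominator positive when q_i = 0. *)
have m0 i : 0 < benefit_slope i -> 0 < benefit_slope i * c / (2 * (q i + 1)).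
  by move=> Ai; rewrite divr_gt0 ?mulr_gt0// ltr_wpDl.
have [t [t0 tu tm]] := exists_pos_lower_bound u0 m0.
have {tu} [trho teps] : t <= rho /\ t <= eps / 2.
  by apply/andP; rewrite -le_min.
(* Scaled so that Gamma = t; each beta_k is then the fraction 1/S of its first-order ceiling xi_k
   t. *)
pose beta k := t / S * xi rho tau lambda k.
have b0 k : 0 <= beta k by rewrite mulr_ge0// divr_ge0// ltW.
have GE : Gamma beta = t by rewrite /Gamma -mulr_sumr divfK// gt_eqF.
have bt k : beta k <= t by rewrite -GE beta_le_Gamma.
have lin i : linear_gain beta i = benefit_slope i * c * t.
  by rewrite /linear_gain GE /beta mulrCA mulr_xi /c; ring.
have gain_pos i : 0 < benefit_slope i ->
    benefit_slope i * c / 2 * t <= gain beta i.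
  move=> Ai; apply: le_trans (gain_ge b0 i); rewrite lin GE -/(q i).
  have : t * (2 * (q i + 1)) <= benefit_slope i * c.
    by rewrite -ler_pdivlMr ?mulr_gt0 ?tm// ltr_wpDl.
  move=> /(ler_wpM2r (ltW t0)).
  have := sqr_ge0 t; lra.
exists beta; split.
- by move=> k; rewrite b0 (le_trans (bt k)).
- by move=> k; apply: le_lt_trans (bt k) _; lra.
- by rewrite GE.
- move=> i; rewrite -subr_ge0 -/(gain beta i).
  have := A0 i; rewrite le_eqVlt => /predU1P[Ai|Ai].
    by apply: gain_indifferent_ge0; rewrite // /beta xiE -Ai mul0r mulr0.
  apply: le_trans (gain_pos i Ai).
  by rewrite mulr_ge0 ?divr_ge0 ?mulr_ge0 ?ltW.
- by exists j; rewrite GE; exact: gain_pos.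
Qed.

End Gain.

Theorem mainTheorem3 (R : realType) (N : nat) (rho tau : R)
    (lambda : 'I_N -> R)
    (rho_gt0 : 0 < rho) (tau_gt0 : 0 < tau)
    (lambda_ge0 : forall i, 0 <= lambda i) :
  small_beneficial_deviation rho tau lambda <->
  ((forall i : 'I_N, 0 <= xi rho tau lambda i) /\
   1 < \sum_(i < N) xi rho tau lambda i).
Proof.
split=> [dev|[xi0 xi1]]; last exact: deviation_of_sum_xi_gt1.
split; last exact: sum_xi_gt1_of_deviation.
by move=> i; rewrite xi_ge0//; exact: benefit_slope_ge0_of_deviation.
Qed.
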